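(* If $L$ is a Latin square of even order, then $E_{2i-1} \equiv E_{2i} \pmod 2$ for each integer $i$.
   Context: A Latin square of order $n$ is an $n\times n$ matrix with symbols from $[n]=\{1,\dots,n\}$ in which each symbol appears exactly once in each row and exactly once in each column. A diagonal of $L$ is a selection of $n$ entries (cells), exactly one from each row and exactly one from each column. $E_m=E_m(L)$ is the number of diagonals of $L$ on which exactly $m$ distinct symbols appear (so $E_m=0$ if $m<1$ or $m>n$). *)

(* Defs.v *)
From mathcomp Require Import all_boot all_order all_algebra.

Set Implicit Arguments.
Unset Strict Implicit.
Unset Printing Implicit Defensive.

(* Rows, columns and symbols are all indexed by 'I_n = {0, ..., n-1} instead
   of {1, ..., n}. *)
Definition latin_square (n : nat) (L : 'M['I_n]_n) : bool :=
  [forall i, forall s, #|[set j | L i j == s]| == 1] &&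
  [forall j, forall s, #|[set i | L i j == s]| == 1].

(* A diagonal is a set of cells (row, column). *)
Definition diagonal (n : nat) (D : {set 'I_n * 'I_n}) : bool :=
  [forall i, #|[set c in D | c.1 == i]| == 1] &&
  [forall j, #|[set c in D | c.2 == j]| == 1].

Definition symbols (n : nat) (L : 'M['I_n]_n) (D : {set 'I_n * 'I_n}) :
  {set 'I_n} := [set L c.1 c.2 | c in D].

(* The index m ranges over all integers, so that E L m is also defined (and is
   0) for negative m. *)
Definition E (n : nat) (L : 'M['I_n]_n) (m : int) : nat :=
  #|[set D : {set 'I_n * 'I_n} | diagonal D && (#|symbols L D|%:Z == m)%R]|.

(* Main.v *)
Require Import Defs.
From mathcomp Require Import all_boot all_order all_algebra.
From mathcomp Require Import fingroup perm.
From mathcomp Require Import zify.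

Import GRing.Theory.

(** For a set T of symbols let N(T) be the number of diagonals all of whose
    symbols lie in T. This is the permanent of the 0/1 matrix marking the cells
    with symbols in T. Modulo 2 the permanent is the determinant, and every
    row of that matrix contains exactly |T| ones; hence when |T| is even the
    all-ones vector is in its kernel over F_2 and N(T) is even
    ([even_diagonals_within]).

    Moebius inversion on the subset lattice has no signs modulo 2, so the
    number of diagonals whose set of symbols is exactly S is congruent to the
    sum of N(T) over all T included in S ([diagonals_exactly]). Summing over
    the sets S of size m and exchanging the sums expresses E_m as the sum over
    T of N(T) times the number of supersets of T of size m. In
    E_(2p+1) + E_(2p+2), by Pascal's rule, N(T) gets the coefficient
    C(n + 1 - |T|, 2p + 2 - |T|). The terms with |T| even vanish because N(T)
    is even. If |T| is odd then, n being even, this is the binomial coefficient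
    of an odd number below an even one, which is even ([even_supersets]). So
    E_(2p+1) + E_(2p+2) is even; for i <= 0 both terms are 0. *)

(** * Diagonals as permutations *)

Definition graph {n : nat} (s : 'S_n) : {set 'I_n * 'I_n} :=
  [set c | s c.1 == c.2].

Definition perm_symbols {n : nat} (L : 'M['I_n]_n) (s : 'S_n) : {set 'I_n} :=
  [set L i (s i) | i : 'I_n].

Lemma mem_graph {n} (s : 'S_n) i : (i, s i) \in graph s.
Proof. by rewrite inE eqxx. Qed.

Lemma graph_inj {n} : injective (@graph n).
Proof.
move=> s t eq_st; apply/permP=> i.
by have := mem_graph s i; rewrite eq_st inE => /eqP.
Qed.

Lemma graph_diagonal {n} (s : 'S_n) : diagonal (graph s).
Proof.
apply/andP; split; apply/forallP=> i; apply/eqP.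
  rewrite -(cards1 (i, s i)); apply: eq_card => -[a b].
  rewrite !inE xpair_eqE /=.
  by rewrite andbC; case: eqP => // ->; rewrite eq_sym.
rewrite -(cards1 ((s^-1)%g i, i)).
apply: eq_card => -[a b]; rewrite !inE xpair_eqE /= andbC [RHS]andbC.
by case: eqP => // ->; rewrite -(inj_eq (@perm_inj _ s) a) permKV.
Qed.

(** Choosing the unique cell of each row gives a map from rows to columns,
    which is injective because each column also holds a single cell. *)
Lemma diagonal_graph {n} (D : {set 'I_n * 'I_n}) :
  diagonal D -> exists s, D = graph s.
Proof.
case/andP=> /forallP rowD /forallP colD.
have rowP i : exists j, (i, j) \in D.
  have /cards1P[[a b] eqD] := rowD i.
  have : (a, b) \in [set c in D | c.1 == i] by rewrite eqD set11.
  by rewrite inE /= => /andP[Dab /eqP <-]; exists b.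
pose f i := xchoose (rowP i).
have Df i : (i, f i) \in D by exact: (xchooseP (rowP i)).
have f_inj : injective f.
  move=> i i' eq_f; have /cards1P[c eqD] := colD (f i).
  have : (i, f i) \in [set c in D | c.2 == f i] by rewrite inE Df /=.
  have : (i', f i) \in [set c in D | c.2 == f i] by rewrite inE eq_f Df /=.
  by rewrite eqD !inE => /eqP <- /eqP[].
exists (perm f_inj); apply/setP=> -[i j]; rewrite inE permE /=.
apply/idP/eqP=> [Dij|<- //].
have /cards1P[c eqD] := rowD i.
have : (i, f i) \in [set c in D | c.1 == i] by rewrite inE Df /=.
have : (i, j) \in [set c in D | c.1 == i] by rewrite inE Dij /=.
by rewrite eqD !inE => /eqP <- /eqP[].
Qed.

Lemma symbols_graph {n} (L : 'M['I_n]_n) (s : 'S_n) :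
  symbols L (graph s) = perm_symbols L s.
Proof.
apply/setP=> x; apply/imsetP/imsetP=> [[[i j]]|[i _ ->]].
  by rewrite inE /= => /eqP <- ->; exists i.
by exists (i, s i); rewrite ?mem_graph.
Qed.

Lemma E_perm {n} (L : 'M['I_n]_n) (m : int) :
  E L m = #|[set s : 'S_n | (#|perm_symbols L s|%:Z == m)%R]|.
Proof.
rewrite /E -(card_imset _ graph_inj); apply: eq_card => D; rewrite inE.
apply/andP/imsetP=> [[/diagonal_graph[s ->]]|[s]].
  by rewrite symbols_graph => ms; exists s; rewrite ?inE.
by rewrite inE => ms ->; rewrite graph_diagonal symbols_graph.
Qed.

(** * Parity of the number of diagonals in a set of symbols *)

Section F2.

Local Open Scope ring_scope.

Lemma natr_F2 (k : nat) : k%:R = (odd k)%:R :> 'F_2.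
Proof. by apply/val_inj; rewrite /= !val_Fp_nat // modn2; case: odd. Qed.

(** Each symbol of [T] occupies exactly one cell of row [i]. *)
Lemma row_count {n : nat} (L : 'M['I_n]_n) (T : {set 'I_n}) i :
  latin_square L -> #|[set j | L i j \in T]| = #|T|.
Proof.
case/andP=> /forallP/(_ i)/forallP rowL _.
rewrite -sum1dep_card (partition_big (L i) (mem T)) //= -sum1_card.
apply: eq_bigr => s Ts; rewrite sum1dep_card -(eqP (rowL s)).
apply: eq_card => j.
by rewrite !inE andbC; case: eqP => // ->.
Qed.

(** Over F_2 the signs in the Leibniz formula are all 1, so the determinant is
    the permanent. *)
Lemma det_F2 {n} (A : 'M['F_2]_n) : \det A = \sum_(s : 'S_n) \prod_i A i (s i).
Proof.
apply: eq_bigr => s _; have -> : -1 = 1 :> 'F_2 by apply/val_inj.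
by rewrite expr1n mul1r.
Qed.

(** The left-hand side is the permanent, that is the determinant, of the
    indicator matrix of the cells with symbols in [T]; all its row sums are
    [#|T|], which is 0 in F_2, so the matrix is singular. *)
Lemma even_diagonals_within {n : nat} (L : 'M['I_n]_n) (T : {set 'I_n}) :
  (0 < n)%N -> latin_square L -> ~~ odd #|T| ->
  \sum_(s : 'S_n) (perm_symbols L s \subset T)%:R = 0 :> 'F_2.
Proof.
move=> n_gt0 L_latin T_even.
pose A : 'M['F_2]_n := \matrix_(i, j) (L i j \in T)%:R.
have -> : \sum_(s : 'S_n) (perm_symbols L s \subset T)%:R = \det A.
  rewrite det_F2; apply: eq_bigr => s _.
  under eq_bigr do rewrite mxE.
  have [/subsetP sT|/subsetPn[x /imsetP[i _ ->] Tx]] := boolP (_ \subset T).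
    rewrite big1 // => i _.
    by have -> : L i (s i) \in T by apply/sT/imsetP; exists i.
  by rewrite (bigD1 i) //= (negPf Tx) mul0r.
apply/eqP; rewrite -det_tr; apply/det0P; exists (const_mx 1).
  by apply/rV0Pn; exists (Ordinal n_gt0); rewrite !mxE oner_eq0.
apply/rowP=> i; rewrite !mxE.
under eq_bigr do rewrite !mxE mul1r.
rewrite -natr_sum -big_mkcond /= sum1dep_card row_count // natr_F2.
by rewrite (negPf T_even).
Qed.

(** * Inclusion-exclusion modulo 2 *)

(** The map [X |-> A :|: X] identifies the subsets of [B :\: A] with the sets
    between [A] and [B]. *)
Lemma card_interval {U : finType} {A B : {set U}} (P : pred nat) :
  A \subset B ->
  #|[set S : {set U} | [&& A \subset S, S \subset B & P #|S|]]| =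
  #|[set X : {set U} | (X \subset B :\: A) && P (#|A| + #|X|)%N]|.
Proof.
move=> sAB; rewrite -!sum1dep_card.
rewrite (reindex_onto (fun X => A :|: X) (fun S => S :\: A)) /=; last first.
  by move=> S /and3P[sAS _ _]; rewrite setDE setUIr setUCr setIT (setUidPr sAS).
apply: eq_bigl => X; rewrite subsetUl subUset sAB /= subsetD.
rewrite setDUl setDv set0U.
have [dXA|ndXA] := boolP [disjoint X & A].
  rewrite (setDidPl dXA) eqxx !andbT cardsU setIC.
  by move: dXA; rewrite -setI_eq0 => /eqP ->; rewrite cards0 subn0.
rewrite andbF /=; apply/negbTE; apply: contra ndXA => /andP[_ /eqP <-].
rewrite -setI_eq0; apply/eqP/setP=> x; rewrite !inE.
by case: (x \in A); rewrite ?andbF.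
Qed.

(** A nonempty interval has [2 ^ #|B :\: A|] elements. This is what makes
    Moebius inversion free of signs modulo 2. *)
Lemma odd_interval {U : finType} (A B : {set U}) :
  odd #|[set T : {set U} | (A \subset T) && (T \subset B)]| = (A == B).
Proof.
have [sAB|nsAB] := boolP (A \subset B); last first.
  rewrite (_ : [set _ | _] = set0); last first.
    apply/setP=> T; rewrite !inE; apply: contraNF nsAB => /andP[].
    exact: subset_trans.
  by rewrite cards0; apply/esym; apply: contraNF nsAB => /eqP ->; apply: subxx.
have -> : #|[set T : {set U} | (A \subset T) && (T \subset B)]| =
    #|powerset (B :\: A)|.
  have := card_interval predT sAB; congr (_ = _); apply: eq_card => X.
    by rewrite !inE /= andbT.
  by rewrite !inE andbT.
rewrite card_powerset oddX /= orbF cards_eq0 setD_eq0.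
by rewrite eqEsubset sAB.
Qed.

(** From [k * 'C(m, k) = m * 'C(m.-1, k.-1)]. *)
Lemma even_bin (m k : nat) : ~~ odd m -> odd k -> ~~ odd 'C(m, k).
Proof.
case: k => // k m_even k_odd; have := congr1 odd (mul_bin_diag m k).
by rewrite !oddM (negPf m_even) k_odd /= => <-.
Qed.

(** Removing [T], the sets counted are the subsets of [~: T] of two consecutive
    sizes [k] and [k.+1], with [k] even (there are none if [#|T|] is too large);
    by Pascal's rule their number is ['C(#|~: T|.+1, k.+1)], where the upper
    index is even and the lower one is odd. *)
Lemma even_supersets {U : finType} (T : {set U}) (p : nat) :
  ~~ odd #|U| -> odd #|T| ->
  ~~ odd #|[set S : {set U} |
      (T \subset S) && ((#|S| == p.*2.+1) || (#|S| == p.*2.+2))]|.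
Proof.
move=> U_even T_odd.
pose P := [pred k | (k == p.*2.+1) || (k == p.*2.+2)].
have -> : #|[set S : {set U} | (T \subset S) && P #|S|]| =
    #|[set X : {set U} | (X \subset ~: T) && P (#|T| + #|X|)%N]|.
  rewrite -setTD -(card_interval _ (subsetT T)); apply: eq_card => S.
  by rewrite !inE subsetT.
have sizeT : #|~: T| = (#|U| - #|T|)%N by have := cardsC T; lia.
have leT : (#|T| <= #|U|)%N by exact: max_card.
have [lt_T|le_T] := ltnP p.*2.+1 #|T|.
  (* Being odd, #|T| exceeds p.*2.+2 as well. *)
  rewrite (_ : [set _ | _] = set0) ?cards0 //.
  by apply/setP=> X; rewrite !inE /=; apply/negbTE; rewrite negb_and; lia.
(* By le_T this subtraction does not truncate, so k is even. *)
pose k := (p.*2.+1 - #|T|)%N.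
have -> : [set X : {set U} | (X \subset ~: T) && P (#|T| + #|X|)%N] =
    [set X : {set U} | X \subset ~: T & #|X| == k] :|:
    [set X : {set U} | X \subset ~: T & #|X| == k.+1].
  apply/setP=> X; rewrite !inE /= -andb_orr; congr (_ && _).
  by rewrite /k; lia.
rewrite cardsU !cards_draws (_ : _ :&: _ = set0) ?cards0 ?subn0; last first.
  apply/setP=> X; rewrite !inE; apply/negbTE.
  by case: eqP => [->|_]; rewrite ?andbF //= (ltn_eqF (ltnSn k)) !andbF.
by rewrite addnC -binS sizeT; apply: even_bin; rewrite /k; lia.
Qed.

(** Moebius inversion modulo 2: after exchanging the sums, a diagonal with set
    of symbols [A] is counted once for each [T] between [A] and [S], which is
    an odd number of times exactly when [A = S]. *)
Lemma diagonals_exactly {n : nat} (L : 'M['I_n]_n) (S : {set 'I_n}) :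
  \sum_(s : 'S_n) (perm_symbols L s == S)%:R =
  \sum_(T : {set 'I_n} | T \subset S)
    \sum_(s : 'S_n) (perm_symbols L s \subset T)%:R :> 'F_2.
Proof.
rewrite exchange_big; apply: eq_bigr => s _.
rewrite -odd_interval -natr_F2 -sum1dep_card natr_sum big_mkcondl /=.
rewrite [RHS]big_mkcond [LHS]big_mkcond; apply: eq_bigr => T _.
by case: (T \subset S); case: (perm_symbols L s \subset T).
Qed.

Lemma E_F2 {n : nat} (L : 'M['I_n]_n) (m : nat) :
  (E L m%:Z)%:R = \sum_(S : {set 'I_n} | #|S| == m)
    \sum_(s : 'S_n) (perm_symbols L s == S)%:R :> 'F_2.
Proof.
rewrite exchange_big E_perm -sum1dep_card natr_sum [LHS]big_mkcond /=.
apply: eq_bigr => s _; rewrite eqz_nat.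
have [ms|nms] := ifP.
  rewrite (bigD1 (perm_symbols L s)) //= eqxx big1 ?addr0 // => S.
  by case/andP=> _ /negPf; rewrite eq_sym => ->.
rewrite big1 // => S mS; case: eqP => // eqS.
by rewrite eqS mS in nms.
Qed.

(** Exchanging the sums over [S] and [T] turns the left-hand side into a
    combination of the numbers of diagonals with symbols in [T]. Those numbers
    vanish for [#|T|] even, and their coefficients do for [#|T|] odd. *)
Lemma E_consecutive_F2 {n : nat} (L : 'M['I_n]_n) (p : nat) :
  (0 < n)%N -> ~~ odd n -> latin_square L ->
  (E L p.*2.+1%:Z)%:R + (E L p.*2.+2%:Z)%:R = 0 :> 'F_2.
Proof.
move=> n_gt0 n_even L_latin.
transitivity (\sum_(S : {set 'I_n} | (#|S| == p.*2.+1) || (#|S| == p.*2.+2))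
    \sum_(T : {set 'I_n} | T \subset S)
      \sum_(s : 'S_n) (perm_symbols L s \subset T)%:R : 'F_2).
  rewrite !E_F2 [RHS](bigID (fun S : {set 'I_n} => #|S| == p.*2.+1)) /=.
  congr (_ + _); apply: eq_big => S; rewrite ?diagonals_exactly //.
    by case: eqP => //=; rewrite andbF.
  by case: (eqVneq #|S| p.*2.+1) => [->|_]; rewrite ?andbT ?andbF //= ltn_eqF.
rewrite (exchange_big_dep predT) //= big1 // => T _.
have [T_odd|T_even] := boolP (odd #|T|); last first.
  by rewrite big1 // => S _; apply: even_diagonals_within.
rewrite sumr_const -mulr_natl natr_F2.
rewrite (_ : odd _ = false) ?mul0r //; apply/negbTE.
rewrite (eq_card (B := [set S : {set 'I_n} |
      (T \subset S) && ((#|S| == p.*2.+1) || (#|S| == p.*2.+2))])).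
  by apply: even_supersets; rewrite ?card_ord.
by move=> S; rewrite !inE andbC.
Qed.

End F2.

Theorem theorem43 (n : nat) (L : 'M['I_n]_n) (n_gt0 : 0 < n)
    (n_even : ~~ odd n) (L_latin : latin_square L) (i : int) :
  E L (2 * i - 1)%R = E L (2 * i)%R %[mod 2].
Proof.
have E_nonpos (m : int) : (m <= 0)%R -> E L m = 0.
  move=> m_le0; rewrite E_perm; apply/eqP; rewrite cards_eq0.
  apply/eqP/setP=> s; rewrite !inE; apply/negbTE.
  have : 0 < #|perm_symbols L s|.
    apply/card_gt0P.
    by exists (L (Ordinal n_gt0) (s (Ordinal n_gt0))); apply: imset_f.
  by lia.
have [i_le0|i_gt0] := boolP (i <= 0)%R; first by rewrite !E_nonpos //; lia.
have [p ->] : exists p : nat, i = Posz p.+1 by exists `|i|%N.-1; lia.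
have -> : (2 * Posz p.+1 - 1)%R = Posz p.*2.+1 by lia.
have -> : (2 * Posz p.+1)%R = Posz p.*2.+2 by lia.
have := E_consecutive_F2 L p n_gt0 n_even L_latin.
rewrite -natrD natr_F2 oddD !modn2.
by do 2!case: odd.
Qed.
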